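(* Let $m\ge 2$ be an integer, $\xi=1/m$, $T>0$, $\alpha>0$, and let $\beta_0,\beta_1\ge0$ be real numbers with $(\beta_0,\beta_1)\ne(0,0)$. Let $M\in\mathbb{R}^{m\times m}$, $\gamma$, $\lambda_k$, $v^{[k]}$ ($k=1,\ldots,m$), $\Lambda$, $V$ and $\varphi_1$ be as defined in the context, let $e_m\in\mathbb{R}^m$ be the $m$-th unit vector and $\psi\in\mathbb{R}^m$. Let $\hat y\in\mathbb{R}^m$ be given. Consider the boundary value problem for $y,p:[0,T]\to\mathbb{R}^m$ $$y'=My-\frac{\gamma^2}{\alpha}e_me_m^{\mathsf T}p,\quad y(0)=\psi,$$ $$p'=-Mp,\quad p(T)=y(T)-\hat y,$$ and write its solution component $y$ as $y(t)=V\eta(t)$, so that $\eta(0)=V^{\mathsf T}\psi$. Then the coefficient vector $\eta(T)$ is given by the unique solution of the linear system $$(I+Q)\,\eta(T)=e^{T\Lambda}\eta(0)+QV^{\mathsf T}\hat y,$$ where the matrix $Q=(q_{k\ell})_{k,\ell=1}^m$ with the elements $$q_{k\ell}=\frac{\gamma^2T}{\alpha}\,v^{[k]}_m\,\varphi_1\big((\lambda_k+\lambda_\ell)T\big)\,v^{[\ell]}_m,\quad k,\ell=1,\ldots,m,$$ is positive semi-definite.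
   Context: Put $\theta=\dfrac{2\beta_1+3\beta_0\xi}{2\beta_1+\beta_0\xi}$ and $\gamma=\dfrac{2}{(2\beta_1+\beta_0\xi)\xi}$. The matrix $M\in\mathbb{R}^{m\times m}$ is symmetric tridiagonal: $\xi^2M$ has diagonal $(-1,-2,\ldots,-2,-\theta)$ (for $m=2$: $(-1,-\theta)$), all entries on the first sub- and superdiagonal equal to $1$, and all other entries zero. Let $\omega_1<\dots<\omega_m$ be the $m$ smallest non-negative solutions of $\tan(\omega)\tan\left(\frac{\omega}{2m}\right)=\frac{\beta_0}{2m\beta_1}$, with the convention $\omega_k=(k-\frac12)\pi$, $k=1,\ldots,m$, if $\beta_1=0$. Define $$\lambda_k=-4m^2\sin^2\left(\frac{\omega_k}{2m}\right),\qquad v^{[k]}_j=\nu_k\cos\left(\omega_k\frac{2j-1}{2m}\right)\ (j=1,\ldots,m),\qquad \nu_k=\frac{2}{\sqrt{2m+\sin(2\omega_k)/\sin(\omega_k/m)}},$$ where for $\omega_k=0$ (which occurs for $\beta_0=0$, $k=1$) the quotient $\sin(2\omega_k)/\sin(\omega_k/m)$ is understood as its limit value $2m$. These are the eigenvalues and corresponding normalized eigenvectors of $M$; $v^{[k]}_m$ denotes the last component of $v^{[k]}$. Set $\Lambda=\mathrm{diag}(\lambda_1,\ldots,\lambda_m)$ and let $V=(v^{[1]},\ldots,v^{[m]})$ be the orthogonal matrix with columns $v^{[k]}$, so that $M=V\Lambda V^{\mathsf T}$. The function $\varphi_1$ is $\varphi_1(z)=\int_0^1e^{zt}\,dt$,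 i.e. $\varphi_1(z)=(e^z-1)/z$ for $z\neq0$ and $\varphi_1(0)=1$. $I$ is the $m\times m$ identity matrix. The boundary value problem is the necessary optimality (Karush-Kuhn-Tucker) system for minimizing $\frac12\|y(T)-\hat y\|_2^2+\frac{\alpha}{2}\int_0^Tu(t)^2\,dt$ subject to $y'=My+\gamma e_mu$, $y(0)=\psi$, after eliminating the control by $u(t)=-\frac{\gamma}{\alpha}e_m^{\mathsf T}p(t)$. *)

(* Defs.v *)
(* MathComp / MathComp-Analysis, over an arbitrary [R : realType]. *)
From HB Require Import structures.
From mathcomp Require Import all_boot all_order all_algebra.
From mathcomp Require Import all_classical all_reals all_analysis.

Set Implicit Arguments.
Unset Strict Implicit.
Unset Printing Implicit Defensive.

Import Order.TTheory GRing.Theory Num.Theory.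
Import numFieldNormedType.Exports.

Local Open Scope classical_set_scope.
Local Open Scope ring_scope.

(* Ordinals are zero-based: [i : 'I_m] stands for the one-based index i + 1. *)

Section Data.
Variable R : realType.

Definition theta (b0 b1 xi : R) : R :=
  (2 * b1 + 3 * b0 * xi) / (2 * b1 + b0 * xi).

Definition gamma (b0 b1 xi : R) : R := 2 / ((2 * b1 + b0 * xi) * xi).

(* For m >= 2 the first and the last diagonal positions are distinct. *)
Definition Mmx (m : nat) (b0 b1 xi : R) : 'M[R]_m :=
  (xi ^+ 2)^-1 *: \matrix_(i < m, j < m)
    (if i == j then
       if i == 0%N :> nat then -1
       else if i.+1 == m then - theta b0 b1 xi
       else -2
     else if (i.+1 == j :> nat) || (j.+1 == i :> nat) then 1
     else 0).

(* [tan] is totalized by [sin x / 0 = 0], so the points where one of the two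
   tangents is undefined have to be excluded explicitly. *)
Definition freq_eq (m : nat) (b0 b1 w : R) : Prop :=
  [/\ cos w != 0, cos (w / (2 * m%:R)) != 0
    & tan w * tan (w / (2 * m%:R)) = b0 / (2 * m%:R * b1)].

Definition is_freqs (m : nat) (b0 b1 : R) (om : 'I_m -> R) : Prop :=
  if b1 == 0 then forall k : 'I_m, om k = (k.+1%:R - 1 / 2) * pi
  else [/\ forall k l : 'I_m, (k < l)%N -> om k < om l,
           forall k : 'I_m, 0 <= om k /\ freq_eq m b0 b1 (om k)
         & forall w : R, 0 <= w -> freq_eq m b0 b1 w ->
             (exists k : 'I_m, w = om k) \/ (forall k : 'I_m, om k < w)].

Definition lambda (m : nat) (om : 'I_m -> R) (k : 'I_m) : R :=
  - (4 * m%:R ^+ 2 * sin (om k / (2 * m%:R)) ^+ 2).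

Definition sin_quot (m : nat) (w : R) : R :=
  if w == 0 then 2 * m%:R else sin (2 * w) / sin (w / m%:R).

Definition nu (m : nat) (om : 'I_m -> R) (k : 'I_m) : R :=
  2 / Num.sqrt (2 * m%:R + sin_quot m (om k)).

(* Here [j] is one-based, as in the formula: the components are
   [vcomp om k 1], ..., [vcomp om k m]. *)
Definition vcomp (m : nat) (om : 'I_m -> R) (k : 'I_m) (j : nat) : R :=
  nu om k * cos (om k * ((2 * j%:R - 1) / (2 * m%:R))).

Definition Vmx (m : nat) (om : 'I_m -> R) : 'M[R]_m :=
  \matrix_(j < m, k < m) vcomp om k j.+1.

Definition Lambdamx (m : nat) (om : 'I_m -> R) : 'M[R]_m :=
  diag_mx (\row_(k < m) lambda om k).

Definition e_last (m : nat) : 'cV[R]_m := \col_(j < m) (j.+1 == m)%:R.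

Definition phi1 (z : R) : R :=
  \int[lebesgue_measure]_(t in `[0, 1]) expR (z * t).

Definition Qmx (m : nat) (b0 b1 xi alpha T : R) (om : 'I_m -> R) : 'M[R]_m :=
  \matrix_(k < m, l < m)
    (gamma b0 b1 xi ^+ 2 * T / alpha *
     vcomp om k m * phi1 ((lambda om k + lambda om l) * T) * vcomp om l m).

Definition expmx (m : nat) (A : 'M[R]_m) : 'M[R]_m :=
  limn (series (fun n : nat => n`!%:R^-1 *: A ^+ n)).

Definition psdmx (m : nat) (A : 'M[R]_m) : Prop :=
  A^T = A /\ forall x : 'cV[R]_m, 0 <= (x^T *m A *m x) 0 0.

(* [f] is differentiable relative to [`[0, T]] at every point of [`[0, T]]
   (one-sidedly at the two ends), with derivative [f']. *)
Definition has_deriv_on (m : nat) (T : R) (f f' : R -> 'cV[R]_m) : Prop :=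
  forall t : R, t \in `[0, T] ->
    (s - t)^-1 *: (f s - f t) @[s --> within `[0, T] t^'] --> f' t.

Definition bvp_solution (m : nat) (b0 b1 xi alpha T : R) (psi yhat : 'cV[R]_m)
    (y p : R -> 'cV[R]_m) : Prop :=
  let M := Mmx m b0 b1 xi in
  [/\ has_deriv_on T y (fun t => M *m y t
        - (gamma b0 b1 xi ^+ 2 / alpha) *: (e_last m *m (e_last m)^T *m p t)),
      y 0 = psi,
      has_deriv_on T p (fun t => - (M *m p t))
    & p T = y T - yhat].

End Data.

(* Main.v *)
(* In the eigenbasis of M the boundary value problem becomes
   eta' = Lambda eta - c w w^T pi, pi' = - Lambda pi with c = gamma^2/alpha and
   w = V^T e_m.  The adjoint is explicit, pi(t) = e^((T-t) Lambda) pi(T), and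
   variation of constants gives eta(T) = e^(T Lambda) eta(0) - Q pi(T), where
   pi(T) = eta(T) - V^T yhat.  The matrix Q is c times a Gram matrix of
   exponentials on [0, T], hence positive semi-definite, so I + Q is invertible;
   this yields uniqueness of eta(T), and existence by solving for eta(T) first.
   Orthogonality of V needs the eigenvalues to be distinct, i.e. that all
   frequencies lie in [0, m pi): by the intermediate value theorem each interval
   [k pi, (k+1) pi), k < m, contains a solution, and pigeonhole concludes. *)
Require Import Defs.
From HB Require Import structures.
From mathcomp Require Import all_boot all_order all_algebra.
From mathcomp Require Import all_classical all_reals all_analysis.
From mathcomp Require Import ring lra.
Import Order.TTheory GRing.Theory Num.Theory.
Import numFieldNormedType.Exports.
Local Open Scope classical_set_scope.
Local Open Scope ring_scope.

Set Implicit Arguments.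
Unset Strict Implicit.
Unset Printing Implicit Defensive.

(** * One-sided derivatives *)

(** A neighbourhood of a matrix contains a product of entrywise neighbourhoods, and finitely many
    events can be intersected in any filter. *)
Lemma cvg_mxP (K : numFieldType) (I : Type) (F : set_system I) (m n : nat)
    (f : I -> 'M[K]_(m, n)) (A : 'M[K]_(m, n)) : Filter F ->
  f x @[x --> F] --> A <-> forall i j, f x i j @[x --> F] --> A i j.
Proof.
move=> FF; split=> [fA i j | fA].
  exact: (cvg_comp f (fun B : 'M[K]_(m, n) => B i j) fA
            (@coord_continuous K m n i j A)).
move=> S [P AP PS].
have H : \forall x \near F, forall i j, P i j (f x i j).
  apply: filter_forall => i; apply: filter_forall => j.
  exact: (fA i j _ (AP i j)).
by move: H; rewrite /nbhs /=; apply: filterS => x Px; apply: PS.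
Qed.

(** Scalar counterpart of [has_deriv_on]: restricting the punctured filter to [S] makes the
    derivative one-sided at an end point of an interval. *)
Definition deriv_within (R : realType) (S : set R) (f : R -> R) (t l : R) :=
  (s - t)^-1 * (f s - f t) @[s --> within S t^'] --> l.

Section DerivWithin.
Context {R : realType} {S : set R} {t : R}.
Implicit Types (f g : R -> R).

Lemma near_within_dnbhs (P : R -> Prop) :
  (forall s, s != t -> P s) -> \forall s \near within S t^', P s.
Proof.
move=> tP; apply: (@cvg_within _ t^' _ S).
by near=> s; apply: tP; near: s; exact: nbhs_dnbhs_neq.
Unshelve. all: by end_near. Qed.

Lemma is_derive_deriv_within f l : is_derive t 1 f l -> deriv_within S f t l.
Proof.
move=> /is_derive1_caratheodory [g [fg gt gtl]].
rewrite /deriv_within -gtl.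
have gtS : g s @[s --> within S t^'] --> g t.
  apply: cvg_within_filter; move: gt; apply: cvg_trans.
  exact: (cvg_app g (@nbhs_dnbhs _ t)).
apply: cvg_trans gtS; apply: near_eq_cvg.
by apply: near_within_dnbhs => s st; rewrite fg mulrCA mulVf ?mulr1 // subr_eq0.
Qed.

(** Asymmetric by design: the second factor is always an exponential or a constant, so it is
    differentiable in the full sense. *)
Lemma deriv_withinM f g l l' :
  deriv_within S f t l -> is_derive t 1 g l' ->
  deriv_within S (fun s => f s * g s) t (l * g t + f t * l').
Proof.
move=> fl gl; have gl' := is_derive_deriv_within gl.
have gt : g s @[s --> within S t^'] --> g t.
  have : {for t, continuous g}.
    by apply/differentiable_continuous/derivable1_diffP; case: gl.
  move=> gt; apply: cvg_within_filter; move: gt; apply: cvg_trans.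
  exact: (cvg_app g (@nbhs_dnbhs _ t)).
rewrite /deriv_within.
(* The quotient is split so that the moving value [g s] multiplies the slope of [f]; hence only
   continuity of [g] is used. *)
rewrite (_ : (fun s => _) = fun s =>
  (s - t)^-1 * (f s - f t) * g s + f t * ((s - t)^-1 * (g s - g t))).
  by apply: cvgD; [exact: cvgM | apply: cvgM => //; exact: cvg_cst].
by apply/funext => s; ring.
Qed.

Lemma deriv_within_sum (I : Type) (r : seq I) (c : I -> R) (f : I -> R -> R)
    (l : I -> R) :
  (forall i, deriv_within S (f i) t (l i)) ->
  deriv_within S (fun s => \sum_(i <- r) c i * f i s) t (\sum_(i <- r) c i * l i).
Proof.
move=> fl; rewrite /deriv_within.
rewrite (_ : (fun s => _) = fun s =>
  \sum_(i <- r) c i * ((s - t)^-1 * (f i s - f i t))).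
  apply: cvg_big => //; first exact: add_continuous.
  by move=> i _; apply: cvgM; [exact: cvg_cst | exact: fl].
apply/funext => s; rewrite -sumrB mulr_sumr; apply: eq_bigr => i _; ring.
Qed.

Lemma deriv_withinD f g l l' :
  deriv_within S f t l -> deriv_within S g t l' ->
  deriv_within S (fun s => f s + g s) t (l + l').
Proof.
move=> fl gl; rewrite /deriv_within.
rewrite (_ : (fun s => _) = fun s =>
  (s - t)^-1 * (f s - f t) + (s - t)^-1 * (g s - g t)); first exact: cvgD.
by apply/funext => s; ring.
Qed.

End DerivWithin.

Lemma deriv_within_is_derive (R : realType) (S : set R) (f : R -> R) (t l : R) :
  nbhs t S -> deriv_within S f t l -> is_derive t 1 f l.
Proof.
move=> St fl; apply/is_derive1_caratheodory.
exists (fun s => if s == t then l else (s - t)^-1 * (f s - f t)).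
split; last by rewrite eqxx.
  move=> s; case: eqP => [-> | /eqP st]; first by rewrite !subrr mulr0.
  by rewrite mulrAC mulVf ?mul1r // subr_eq0.
apply/continuous_withinNx; rewrite eqxx.
move: fl; rewrite /deriv_within.
(* As [S] is a neighbourhood of [t], restricting to it does not change the filter. *)
have -> : within S t^' = t^'.
  apply/seteqP; split => A.
    move=> SA; have St' : t^' S by exact: nbhs_dnbhs.
    have {}SA : t^' (fun s => S s -> A s) := SA.
    have SAS := @filterI _ _ (dnbhs_filter t) _ _ SA St'.
    by apply: (@filterS _ _ (dnbhs_filter t) _ _ _ SAS) => s [+ Ss]; exact.
  by apply: (@filterS _ _ (dnbhs_filter t)) => s As _.
move=> fl; apply: cvg_trans fl; apply: near_eq_cvg.
near=> s; rewrite ifF //; apply/negbTE; near: s; exact: nbhs_dnbhs_neq.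
Unshelve. all: by end_near. Qed.

Lemma deriv_within_continuous (R : realType) (S : set R) (f : R -> R) (t l : R) :
  deriv_within S f t l -> f s @[s --> within S (nbhs t)] --> f t.
Proof.
move=> fl.
have H : f s @[s --> within S t^'] --> f t.
  have H0 : ((s - t) * ((s - t)^-1 * (f s - f t)) + f t)
      @[s --> within S t^'] --> (t - t) * l + f t.
    apply: cvgD; last exact: cvg_cst.
    apply: cvgM => //; apply: cvgB; last exact: cvg_cst.
    by apply: cvg_within_filter; exact: nbhs_dnbhs.
  rewrite subrr mul0r add0r in H0; apply: cvg_trans H0; apply: near_eq_cvg.
  apply: near_within_dnbhs => s st.
  by rewrite mulrA mulfV ?subr_eq0 // mul1r subrK.
move=> A fA; have : nbhs t (fun s => s != t -> S s -> A (f s)) := H A fA.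
apply: filterS => s; case: (eqVneq s t) => [-> _ _ | _]; last exact.
exact: nbhs_singleton fA.
Qed.

(** Mean value theorem on [[0, t]]: interior points have a genuine derivative, and the one-sided
    ones give continuity up to the ends. *)
Lemma deriv_within_0_cst (R : realType) (T : R) (f : R -> R) :
  (forall t, t \in `[0, T] -> deriv_within [set` `[0, T]] f t 0) ->
  forall t, t \in `[0, T] -> f t = f 0.
Proof.
move=> f0 t; rewrite in_itv /= => /andP[t0 tT].
have [||c _] := @MVT_segment R f (fun=> 0) 0 t t0.
- move=> s; rewrite in_itv /= => /andP[s0 st].
  apply: (@deriv_within_is_derive _ [set` `[0, T]]).
    have : nbhs s [set` `]0, T[] .
      by apply: near_in_itvoo; rewrite in_itv /= s0 (lt_le_trans st tT).
    by apply: filterS => u; rewrite /= !in_itv /= => /andP[/ltW -> /ltW ->].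
  by apply: f0; rewrite in_itv /= (ltW s0) (le_trans (ltW st) tT).
- apply: (@continuous_subspaceW _ _ _ [set` `[0, T]]).
    move=> s /=; rewrite !in_itv /= => /andP[-> st]; exact: le_trans st tT.
  apply/subspace_continuousP => s sT; exact: deriv_within_continuous (f0 s sT).
- by rewrite mul0r => /eqP; rewrite subr_eq0 => /eqP.
Qed.

(** * Exponentials *)

(* The integral of [expR (a * s)] over [s] in [0, t]. *)
Definition primexp (R : realType) (a t : R) : R :=
  if a == 0 then t else (expR (a * t) - 1) / a.

Section Primexp.
Context {R : realType}.
Implicit Types a t : R.

Lemma is_derive_expRM a t :
  is_derive t 1 (fun s => expR (a * s)) (a * expR (a * t)).
Proof.
rewrite mulrC; apply: (@is_derive1_comp _ expR (fun s => a * s)).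
rewrite -[X in is_derive _ _ _ X]mulr1.
exact: (@is_deriveZ _ _ _ id a t 1 1 (is_derive_id _ _)).
Qed.

Lemma is_derive_primexp a t : is_derive t 1 (primexp a) (expR (a * t)).
Proof.
have [->|a0] := eqVneq a 0.
  rewrite mul0r expR0 /primexp eqxx; exact: is_derive_id.
have -> : primexp a = a^-1 \*: (fun s => expR (a * s) - 1).
  by apply/funext => s; rewrite /primexp (negbTE a0) mulrC.
have -> : expR (a * t) = a^-1 *: (a * expR (a * t) - 0).
  by rewrite subr0 /GRing.scale /= mulrA mulVf // mul1r.
apply: is_deriveZ; apply: is_deriveB; exact: is_derive_expRM.
Qed.

Lemma primexp0 a : primexp a 0 = 0.
Proof. by rewrite /primexp mulr0 expR0 subrr mul0r if_same. Qed.

Lemma primexp_scale a t : t * primexp (a * t) 1 = primexp a t.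
Proof.
rewrite /primexp mulf_eq0 mulr1.
have [->|t0] := eqVneq t 0; first by rewrite orbT mulr0 expR0 subrr !mul0r if_same.
rewrite orbF; case: ifPn => [_|a0]; first by rewrite mulr1.
by field; rewrite a0.
Qed.

(** The substitution s -> t - s in the integral of [expR (a * s)] over [0, t]. *)
Lemma primexpN a t : expR (a * t) * primexp (- a) t = primexp a t.
Proof.
rewrite /primexp oppr_eq0; case: ifPn => [/eqP ->|a0].
  by rewrite mul0r expR0 mul1r.
have e0 : expR (a * t) != 0 by rewrite expR_eq0.
by rewrite mulNr expRN; field; rewrite ?oppr_eq0 ?a0 ?e0.
Qed.

Lemma continuous_is_derive (f : R -> R) (l : R) t :
  is_derive t 1 f l -> {for t, continuous f}.
Proof. by case=> df _; apply/differentiable_continuous/derivable1_diffP. Qed.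

Lemma phi1E a : phi1 a = primexp a 1.
Proof.
rewrite /phi1 /Rintegral (@continuous_FTC2 _ _ (primexp a)) //.
- by rewrite -EFinB /= primexp0 subr0.
- apply: continuous_subspaceT => t; exact: continuous_is_derive (is_derive_expRM a t).
- have cp t : {for t, continuous (primexp a)}.
    exact: continuous_is_derive (is_derive_primexp a t).
  split; first by move=> t _; case: (is_derive_primexp a t).
  + exact: cvg_at_right_filter (cp 0).
  + exact: cvg_at_left_filter (cp 1).
- by move=> t _; rewrite derive1E; case: (is_derive_primexp a t).
Qed.

(** Turns the factor T phi1((lambda_k + lambda_l) T) in the entries of Q into an integral over
    [0, T]. *)
Lemma phi1_scale a t : t * phi1 (a * t) = primexp a t.
Proof. by rewrite phi1E primexp_scale. Qed.

(* The double sum is the integral over [0, t] of the square of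
   [\sum_k c k * expR (d k * s)]. *)
Lemma primexp_gram_ge0 m (d c : 'I_m -> R) t : 0 <= t ->
  0 <= \sum_(k < m) \sum_(l < m) c k * c l * primexp (d k + d l) t.
Proof.
move=> t0.
pose F (s : R) := \sum_(k < m) \sum_(l < m) c k * c l * primexp (d k + d l) s.
have dF (s : R) : is_derive s 1 F ((\sum_(k < m) c k * expR (d k * s)) ^+ 2).
  have -> : F = \sum_(k < m) \sum_(l < m) ((c k * c l) \*: primexp (d k + d l)).
    by apply/funext => u; rewrite fct_sumE; apply: eq_bigr => k _; rewrite fct_sumE.
  rewrite expr2 mulr_suml; apply: is_derive_sum => k; rewrite mulr_sumr.
  apply: is_derive_sum => l.
  have -> : c k * expR (d k * s) * (c l * expR (d l * s)) =
      (c k * c l) *: expR ((d k + d l) * s).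
    by rewrite mulrDl expRD /GRing.scale /=; ring.
  by apply: is_deriveZ; exact: is_derive_primexp.
have F0 : F 0 = 0.
  by rewrite /F big1 // => k _; rewrite big1 // => l _; rewrite primexp0 mulr0.
rewrite -[X in X <= _]F0; apply: (@ger0_derive1_ndecr _ F 0 t) => //.
- by move=> s _; rewrite derive1E; case: (dF s) => _ ->; exact: sqr_ge0.
- apply: continuous_subspaceT => s; exact: continuous_is_derive (dF s).
Qed.

End Primexp.

Lemma diag_mxX (R : pzRingType) m (d : 'rV[R]_m) n :
  diag_mx d ^+ n = diag_mx (map_mx (fun x => x ^+ n) d).
Proof.
elim: n => [|n IHn].
  by apply/matrixP => i j; rewrite expr0 !mxE expr0.
rewrite exprS IHn -[LHS]/(_ *m _) mulmx_diag; congr diag_mx.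
by apply/rowP => j; rewrite !mxE exprS.
Qed.

(** Entrywise, the partial sums are those of the scalar exponential series on the diagonal and
    constantly 0 off it. *)
Lemma expmx_diag (R : realType) m (d : 'rV[R]_m) :
  expmx (diag_mx d) = diag_mx (map_mx expR d).
Proof.
apply: (cvg_lim (@norm_hausdorff _ _)); apply/cvg_mxP => i j.
rewrite !mxE.
rewrite (_ : (fun n => _) = (fun n => series (exp_coeff (d 0 i)) n *+ (i == j))).
  have [_|_] := eqVneq i j; last exact: cvg_cst.
  exact: is_cvg_series_exp_coeff.
apply/funext => n; rewrite /series /= summxE -sumrMnl; apply: eq_bigr => k _.
by rewrite diag_mxX !mxE /exp_coeff /= mulrnAr [_^-1 * _]mulrC.
Qed.

(** * Spectral decomposition of M *)

Section Frequencies.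
Context {R : realType}.
Implicit Types w s c : R.

Lemma cosDnpi k s : cos (k%:R * pi + s) = (-1) ^+ k * cos s :> R.
Proof.
rewrite addrC mulr_natl; have := alternatingn (@cosDpi R) k s.
by move=> ->.
Qed.

Lemma tanDnpi k s : tan (k%:R * pi + s) = tan s :> R.
Proof. rewrite addrC mulr_natl; exact: (periodicn (@tanDpi R)). Qed.

(** Write w = k pi + s with s in [0, pi/2]. By periodicity of [tan] the equation becomes, after
    clearing cosines, g(s) = 0; here g(0) <= 0 < g(pi/2), so the intermediate value theorem
    applies. *)
Lemma freq_eq_exists m (b0 b1 : R) (k : nat) :
  (k < m)%N -> 0 <= b0 / (2 * m%:R * b1) ->
  exists2 w, k%:R * pi <= w < k.+1%:R * pi & freq_eq m b0 b1 w.
Proof.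
move=> km c0; set c := _ / _ in c0.
have m0 : (0 < m)%N by exact: leq_ltn_trans km.
have mR : 0 < m%:R :> R by rewrite ltr0n.
have pi0 := @pi_gt0 R.
have kR : k%:R + 1 <= m%:R :> R by rewrite -[1]/1%:R -natrD ler_nat addn1.
have k0 : 0 <= k%:R :> R by rewrite ler0n.
(* This is w / (2m); it stays below pi/2 because k + 1/2 < m. *)
pose h (s : R) := (k%:R * pi + s) / (2 * m%:R).
have h_itv s : 0 <= s <= pi / 2 -> 0 <= h s < pi / 2.
  move=> /andP[s0 s1]; rewrite /h divr_ge0 ?addr_ge0 ?mulr_ge0 ?ler0n ?(ltW pi0) //=.
  by rewrite ltr_pdivrMr ?mulr_gt0 //; nra.
pose g (s : R) := sin s * sin (h s) - c * (cos s * cos (h s)).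
have hcont : continuous h.
  move=> s; apply: cvgM; last exact: cvg_cst.
  by apply: cvgD; [exact: cvg_cst | exact: cvg_id].
have gcont : continuous g.
  move=> s; apply: cvgB.
    apply: cvgM; first exact: continuous_sin.
    exact: (continuous_comp (hcont s) (@continuous_sin R _)).
  apply: cvgM; first exact: cvg_cst.
  apply: cvgM; first exact: continuous_cos.
  exact: (continuous_comp (hcont s) (@continuous_cos R _)).
have cosh_gt0 s : 0 <= s <= pi / 2 -> 0 < cos (h s).
  move=> /h_itv /andP[h0 h1]; apply: cos_gt0_pihalf; rewrite h1 andbT.
  by apply: lt_le_trans h0; rewrite oppr_lt0; lra.
have g0 : g 0 <= 0.
  rewrite /g sin0 cos0 mul0r mul1r sub0r oppr_le0 mulr_ge0 //.
  by apply/ltW/cosh_gt0; rewrite lexx; lra.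
have g1 : 0 < g (pi / 2).
  rewrite /g sin_pihalf cos_pihalf mul1r mul0r mulr0 subr0.
  have /andP[_ h1] : 0 <= h (pi / 2) < pi / 2 by apply: h_itv; rewrite lexx; lra.
  apply: sin_gt0_pihalf; rewrite h1 andbT divr_gt0 ?mulr_gt0 //.
  by rewrite ltr_wpDl ?divr_gt0 // mulr_ge0 // ltW.
have pi20 : 0 <= pi / 2 :> R by lra.
have g01 : Num.min (g 0) (g (pi / 2)) <= 0 <= Num.max (g 0) (g (pi / 2)).
  by rewrite ge_min g0 le_max (ltW g1) orbT.
have [s] := IVT pi20 (continuous_subspaceT gcont) g01.
rewrite in_itv /= => /andP[s0 s1] gs.
(* The end point is excluded because g is positive there; this keeps cos s nonzero, as [freq_eq]
   demands. *)
have {}s1 : s < pi / 2.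
  rewrite lt_neqAle s1 andbT; apply/eqP => sE.
  by move: g1; rewrite -sE gs ltxx.
have cs : 0 < cos s.
  by apply: cos_gt0_pihalf; rewrite s1 andbT; apply: lt_le_trans s0; lra.
have ch : 0 < cos (h s) by apply: cosh_gt0; rewrite s0 ltW.
exists (k%:R * pi + s).
  rewrite lerDl s0 /= -natr1 mulrDl mul1r ltrD2l; lra.
split.
- by rewrite cosDnpi mulf_neq0 ?signr_eq0 // gt_eqF.
- by rewrite -/(h s) gt_eqF.
rewrite tanDnpi -/(h s) -/c /tan mulf_div.
have /eqP := gs; rewrite subr_eq0 => /eqP ->.
by rewrite mulfK // mulf_neq0 ?gt_eqF.
Qed.

(* The equation for [tan] with denominators cleared also covers [b1 = 0]. *)
Lemma freqs_spec m (b0 b1 : R) (om : 'I_m -> R) : is_freqs b0 b1 om ->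
  0 <= b0 -> 0 <= b1 ->
  [/\ injective om, forall k, 0 <= om k < m%:R * pi
    & forall k, 2 * m%:R * b1 * (sin (om k) * sin (om k / (2 * m%:R)))
        = b0 * (cos (om k) * cos (om k / (2 * m%:R)))].
Proof.
have pi0 := @pi_gt0 R.
rewrite /is_freqs; case: eqVneq => [-> omE _ _|b10 [om_lt om_sol om_min] b00 b1_ge0].
  split=> [k l|k|k].
  - rewrite !omE => /(mulIf (lt0r_neq0 pi0)) /addIr /eqP.
    by rewrite eqr_nat eqSS => /eqP /val_inj.
  - have km : k.+1%:R <= m%:R :> R by rewrite ler_nat.
    have k1 : 1 <= k.+1%:R :> R by rewrite ler1n.
    by rewrite omE mulr_ge0 ?ltr_pM2r //=; lra.
  (* For b1 = 0 the frequencies are zeros of the cosine, so both sides of the cleared equation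
     vanish. *)
  - have -> : om k = k%:R * pi + pi / 2 by rewrite omE -natr1; field.
    by rewrite mulr0 mul0r cosDnpi cos_pihalf !(mulr0, mul0r).
have om_inj : injective om.
  move=> k l okl; apply/val_inj/eqP; case: ltngtP => // /om_lt.
    by rewrite okl ltxx.
  by rewrite okl ltxx.
have c0 : 0 <= b0 / (2 * m%:R * b1) by rewrite divr_ge0 ?mulr_ge0.
split=> // k; last first.
  have m0 : m%:R != 0 :> R by rewrite pnatr_eq0 -lt0n (leq_ltn_trans _ (ltn_ord k)).
  have [_ [cw ch]] := om_sol k; rewrite /tan mulf_div => /eqP.
  have d0 : 2 * m%:R * b1 != 0 by rewrite !mulf_neq0 // pnatr_eq0.
  by rewrite eqr_div ?mulf_neq0 // => /eqP <-; ring.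
(* Suppose om k >= m pi. The m intervals below m pi supply m distinct solutions less than om k. Each
   is some om i, since otherwise it would exceed every frequency; so by counting they exhaust all
   frequencies, including om k itself, a contradiction. *)
have [-> _] := om_sol k; rewrite /= ltNge; apply/negP => omk.
have /choice [w w_spec] : forall j : 'I_m, exists w,
    (j%:R * pi <= w < j.+1%:R * pi) /\ freq_eq m b0 b1 w.
  by move=> j; have [w] := freq_eq_exists (ltn_ord j) c0; exists w.
have w_lt j : w j < om k.
  have [/andP[_ wj] _] := w_spec j; apply: lt_le_trans wj (le_trans _ omk).
  by rewrite ler_pM2r // ler_nat.
have /choice [f wf] : forall j : 'I_m, exists i, w j = om i.
  move=> j; have [/andP[wj _] feq] := w_spec j.
  have w0 : 0 <= w j by apply: le_trans wj; rewrite mulr_ge0 // ltW.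
  case: (om_min _ w0 feq) => // /(_ k); by rewrite ltNge ltW.
have f_inj : injective f.
  have w_le (i j : 'I_m) : (i < j)%N -> w i < w j.
    move=> ij; have [/andP[_ wi] _] := w_spec i.
    have [/andP[wj _] _] := w_spec j; apply: lt_le_trans wi (le_trans _ wj).
    by rewrite ler_pM2r // ler_nat.
  move=> i j fij; have wij : w i = w j by rewrite !wf fij.
  by apply/val_inj/eqP; case: ltngtP => // /w_le; rewrite wij ltxx.
have [g _ gK] := injF_bij f_inj.
by have := w_lt (g k); rewrite wf gK ltxx.
Qed.

End Frequencies.

(** * Eigenpairs of M and orthogonality of V *)

Section Eigenvectors.
Context {R : realType}.

(** Moving the index by one moves the angle by 2h, h = om k / (2m), so the second difference of the
    cosine produces the factor 2 (cos 2h - 1) = -4 sin^2 h. *)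
Lemma vcomp_rec m (om : 'I_m -> R) k j :
  vcomp om k j + vcomp om k j.+2 - 2 * vcomp om k j.+1
  = - (4 * sin (om k / (2 * m%:R)) ^+ 2) * vcomp om k j.+1.
Proof.
rewrite /vcomp; set h := om k / (2 * m%:R).
set a := om k * ((2 * j.+1%:R - 1) / (2 * m%:R)).
have -> : om k * ((2 * j%:R - 1) / (2 * m%:R)) = a - (h + h).
  by rewrite /a /h -natr1; ring.
have -> : om k * ((2 * j.+2%:R - 1) / (2 * m%:R)) = a + (h + h).
  by rewrite /a /h -!natr1; ring.
rewrite (cosB a) (cosD a); have -> : cos (h + h) = 1 - 2 * sin h ^+ 2.
  by rewrite cosD -!expr2 cos2sin2; ring.
ring.
Qed.

(** The discrete Neumann condition at the left end: the angles at indices 0 and 1 are opposite. It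
    accounts for the first diagonal entry -1. *)
Lemma vcomp_0 m (om : 'I_m -> R) k : vcomp om k 0 = vcomp om k 1.
Proof.
by rewrite /vcomp -[in LHS]cosN; congr (_ * cos _); rewrite mulr0 mulr1; ring.
Qed.

(* The entry theta of M encodes the Robin condition: eliminating the ghost value
   at index [m.+1] turns the last row into the interior three-term recurrence. *)
Lemma vcomp_ghost m (b0 b1 : R) (om : 'I_m -> R) k :
  2 * m%:R * b1 + b0 != 0 ->
  2 * m%:R * b1 * (sin (om k) * sin (om k / (2 * m%:R)))
    = b0 * (cos (om k) * cos (om k / (2 * m%:R))) ->
  vcomp om k m.+1 = (2 - theta b0 b1 (1 / m%:R)) * vcomp om k m.
Proof.
move=> D0 bc; have m0 : m%:R != 0 :> R.
  by rewrite pnatr_eq0 -lt0n (leq_ltn_trans _ (ltn_ord k)).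
rewrite /vcomp; set h := om k / (2 * m%:R) in bc *.
have -> : om k * ((2 * m.+1%:R - 1) / (2 * m%:R)) = om k + h.
  by rewrite /h -natr1; field.
have -> : om k * ((2 * m%:R - 1) / (2 * m%:R)) = om k - h by rewrite /h; field.
have -> : 2 - theta b0 b1 (1 / m%:R) = (2 * m%:R * b1 - b0) / (2 * m%:R * b1 + b0).
  have D1 : 2 * b1 + b0 / m%:R != 0.
    apply: contraNneq D0 => D1.
    have -> : 2 * m%:R * b1 + b0 = m%:R * (2 * b1 + b0 / m%:R) by field.
    by rewrite D1 mulr0.
  by rewrite /theta; field; rewrite ?m0 ?D0.
rewrite mulrCA; congr (_ * _); rewrite cosD cosB mulrAC.
apply: (mulIf D0); rewrite divfK //.
(* With the denominator cleared, the two sides differ by twice the residual of the frequency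
   equation. *)
apply/eqP; rewrite -subr_eq0; apply/eqP.
transitivity (2 * (b0 * (cos (om k) * cos h) - 2 * m%:R * b1 * (sin (om k) * sin h))).
  ring.
by rewrite bc subrr mulr0.
Qed.

(** The sum telescopes: 2 sin(2h) cos x = sin(x + 2h) - sin(x - 2h), and consecutive x are 4h
    apart. *)
Lemma sum_cos_odd (h : R) n :
  sin (2 * h) * (2 * \sum_(j < n) cos (h * (2 * (2 * j%:R + 1))))
  = sin (4 * (h * n%:R)).
Proof.
elim: n => [|n IHn]; first by rewrite big_ord0 !mulr0 sin0.
rewrite big_ord_recr /=; set c := cos _; rewrite !mulrDr IHn {}/c.
have -> : 4 * (h * n%:R) = h * (2 * (2 * n%:R + 1)) - 2 * h by ring.
have -> : 4 * (h * n.+1%:R) = h * (2 * (2 * n%:R + 1)) + 2 * h by rewrite -natr1; ring.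
by rewrite sinB sinD; ring.
Qed.

(** Halving the angle, cos^2 x = (1 + cos 2x) / 2, reduces the sum of squares to [sum_cos_odd],
    which yields exactly the quotient inside [nu]. The bound on om k makes sin(om k / m) positive
    unless om k = 0. *)
Lemma vcomp_norm m (om : 'I_m -> R) k : 0 <= om k < m%:R * pi ->
  \sum_(j < m) vcomp om k j.+1 ^+ 2 = 1.
Proof.
move=> /andP[w0 w1]; have m_gt0 : (0 < m)%N by exact: leq_ltn_trans (ltn_ord k).
have m0 : 0 < m%:R :> R by rewrite ltr0n.
set h := om k / (2 * m%:R).
have vE (j : 'I_m) : vcomp om k j.+1 = nu om k * cos (h * (2 * j%:R + 1)).
  by rewrite /vcomp; congr (_ * cos _); rewrite /h -natr1; field; rewrite gt_eqF.
have S_E : 2 * m%:R + sin_quot m (om k) = 4 * \sum_(j < m) cos (h * (2 * j%:R + 1)) ^+ 2.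
  have -> : \sum_(j < m) cos (h * (2 * j%:R + 1)) ^+ 2 =
      m%:R / 2 + (\sum_(j < m) cos (h * (2 * (2 * j%:R + 1)))) / 2.
    have -> : m%:R = \sum_(j < m) 1 :> R by rewrite sumr_const card_ord.
    rewrite -mulrDl -big_split /= mulr_suml; apply: eq_bigr => j _.
    have -> : h * (2 * (2 * j%:R + 1)) = h * (2 * j%:R + 1) *+ 2 by ring.
    by rewrite cos_mulr2n; field.
  rewrite mulrDr; congr (_ + _); first by field.
  (* At frequency 0 every cosine is 1, which matches the limit value 2m. *)
  rewrite /sin_quot; case: eqVneq => [w_eq0|wn0].
    rewrite (eq_bigr (fun=> 1)) => [|j _]; last by rewrite /h w_eq0 !mul0r cos0.
    by rewrite sumr_const card_ord; field.
  have sh : 0 < sin (2 * h).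
    apply: sin_gt0_pi; rewrite /h; have -> : 2 * (om k / (2 * m%:R)) = om k / m%:R.
      by field; rewrite gt_eqF.
    apply/andP; split; first by rewrite divr_gt0 // lt_def wn0.
    by rewrite ltr_pdivrMr // mulrC.
  have -> : om k / m%:R = 2 * h by rewrite /h; field; rewrite gt_eqF.
  have -> : 2 * om k = 4 * (h * m%:R) by rewrite /h; field; rewrite gt_eqF.
  by rewrite -sum_cos_odd; field; rewrite gt_eqF.
(* The term j = 0 is already positive, its angle h lying in [0, pi/2). *)
have S_gt0 : 0 < \sum_(j < m) cos (h * (2 * j%:R + 1)) ^+ 2.
  rewrite (bigD1 (Ordinal m_gt0)) //= ltr_pwDl ?sumr_ge0 // => [|j _]; last exact: sqr_ge0.
  rewrite mulr0 add0r mulr1 exprn_gt0 // cos_gt0_pihalf //.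
  have pi0 := @pi_gt0 R.
  have h0 : 0 <= h by rewrite divr_ge0 // mulr_ge0 // ltW.
  have h1 : h < pi / 2 by rewrite /h ltr_pdivrMr ?mulr_gt0 //; lra.
  by rewrite h1 andbT; lra.
under eq_bigr do rewrite vE exprMn.
rewrite -mulr_sumr /nu S_E exprMn exprVn sqr_sqrtr ?mulr_ge0 // ?ltW //.
by field; rewrite gt_eqF.
Qed.

Lemma sum_pick_ord m (f : nat -> R) (a : nat) :
  \sum_(j < m) (a == j :> nat)%:R * f j = if (a < m)%N then f a else 0.
Proof.
case: ifPn => [am|]; last first.
  rewrite -leqNgt => ma; rewrite big1 // => j _.
  by rewrite gtn_eqF ?mul0r // (leq_trans (ltn_ord j)).
rewrite (bigD1 (Ordinal am)) //= eqxx mul1r big1 ?addr0 // => j.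
by rewrite -val_eqE /= eq_sym => /negbTE ->; rewrite mul0r.
Qed.

(** Each row reduces to at most three terms. [vcomp_0] and [vcomp_ghost] then bring the first and
    last rows to the interior recurrence [vcomp_rec], whose factor times m^2 is the eigenvalue. *)
Lemma Mmx_eigen m (b0 b1 : R) (om : 'I_m -> R) : (2 <= m)%N ->
  2 * m%:R * b1 + b0 != 0 ->
  (forall k, 2 * m%:R * b1 * (sin (om k) * sin (om k / (2 * m%:R)))
        = b0 * (cos (om k) * cos (om k / (2 * m%:R)))) ->
  Mmx m b0 b1 (1 / m%:R) *m Vmx om = Vmx om *m Lambdamx om.
Proof.
move=> m2 D0 bc; apply/matrixP => i k; rewrite mul_mx_diag !mxE.
set d := if i == 0%N :> nat then -1 else if i.+1 == m then - theta b0 b1 (1 / m%:R) else -2.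
have m0 : m%:R != 0 :> R by rewrite pnatr_eq0 -lt0n (leq_trans _ m2).
transitivity (m%:R ^+ 2 * (d * vcomp om k i.+1 +
  (if (i.+1 < m)%N then vcomp om k i.+2 else 0) +
  (if (0 < i)%N then vcomp om k i else 0))).
  rewrite -(sum_pick_ord m (fun j => vcomp om k j.+1)).
  have -> : (if (0 < i)%N then vcomp om k i else 0) =
     \sum_(j < m) (j.+1 == i)%:R * vcomp om k j.+1.
    case: (posnP i) => [i0|i_gt0]; first by rewrite big1 // => j _; rewrite i0 mul0r.
    have := sum_pick_ord m (fun j => vcomp om k j.+1) i.-1.
    rewrite (leq_ltn_trans (leq_pred i)) ?ltn_ord // prednK // => <-.
    by apply: eq_bigr => j _; rewrite -[in RHS](prednK i_gt0) eqSS eq_sym.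
  have -> : d * vcomp om k i.+1 = \sum_(j < m) (i == j :> nat)%:R * (d * vcomp om k j.+1).
    by rewrite (sum_pick_ord m (fun j => d * vcomp om k j.+1)) ltn_ord.
  rewrite -!big_split mulr_sumr /=; apply: eq_bigr => j _; rewrite !mxE -/d.
  have -> : (1 / m%:R) ^- 2 = m%:R ^+ 2 :> R by rewrite mul1r exprVn invrK.
  rewrite -mulrA; congr (_ * _).
  have [->|ij] := eqVneq i j.
    by rewrite eqxx !gtn_eqF // !mul0r !addr0 mul1r.
  rewrite -val_eqE /= in ij; rewrite (negbTE ij) mul0r add0r.
  case: (eqVneq i.+1 j) => [<-|_] /=; last by rewrite mul0r add0r; case: ifP.
  by rewrite gtn_eqF // mul0r addr0.
rewrite /lambda; have := vcomp_rec om k i; set s := sin _ ^+ 2.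
have -> : vcomp om k i.+1 * - (4 * m%:R ^+ 2 * s) = m%:R ^+ 2 * (- (4 * s) * vcomp om k i.+1).
  ring.
move=> <-; congr (_ * _); rewrite /d.
have [i0|i_gt0] := posnP i.
  by rewrite i0 m2 -vcomp_0; ring.
case: (eqVneq i.+1 m) => [im|im].
  rewrite im ltnn (vcomp_ghost D0 (bc k)); ring.
by rewrite ltn_neqAle im ltn_ord /=; ring.
Qed.

(** The angles om k / (2m) lie in [0, pi/2), where the sine is nonnegative and injective, so its
    square separates them. *)
Lemma lambda_inj m (om : 'I_m -> R) : (forall k, 0 <= om k < m%:R * pi) ->
  injective om -> injective (lambda om).
Proof.
move=> om_itv om_inj k l /oppr_inj.
have m0 : 0 < m%:R :> R by rewrite ltr0n (leq_ltn_trans _ (ltn_ord k)).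
have pi0 := @pi_gt0 R.
have h_itv j : 0 <= om j / (2 * m%:R) < pi / 2.
  have /andP[w0 w1] := om_itv j; rewrite divr_ge0 ?mulr_ge0 ?(ltW m0) //=.
  by rewrite ltr_pdivrMr ?mulr_gt0 //; lra.
have /andP[hk0 hk1] := h_itv k; have /andP[hl0 hl1] := h_itv l.
have m4 : 4 * m%:R ^+ 2 != 0 :> R by rewrite mulf_neq0 // expf_neq0 // gt_eqF.
move=> /(mulfI m4) /eqP; rewrite eqrXn2 // ?sin_ge0_pi //; last 2 first.
- by rewrite hk0; lra.
- by rewrite hl0; lra.
move=> /eqP /sin_inj; rewrite !in_itv /=.
have -> : - (pi / 2) <= om k / (2 * m%:R) <= pi / 2 by apply/andP; lra.
have -> : - (pi / 2) <= om l / (2 * m%:R) <= pi / 2 by apply/andP; lra.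
move=> /(_ isT isT) /mulIf -/(_ _) hkl; apply: om_inj; apply: hkl.
by rewrite invr_neq0 // mulf_neq0 // gt_eqF.
Qed.

Lemma Vmx_orthogonal m (b0 b1 : R) (om : 'I_m -> R) : (2 <= m)%N ->
  2 * m%:R * b1 + b0 != 0 -> injective om ->
  (forall k, 0 <= om k < m%:R * pi) ->
  (forall k, 2 * m%:R * b1 * (sin (om k) * sin (om k / (2 * m%:R)))
        = b0 * (cos (om k) * cos (om k / (2 * m%:R)))) ->
  (Vmx om)^T *m Vmx om = 1%:M.
Proof.
move=> m2 D0 om_inj om_itv bc.
have MV := Mmx_eigen m2 D0 bc.
have MT : (Mmx m b0 b1 (1 / m%:R))^T = Mmx m b0 b1 (1 / m%:R).
  apply/matrixP => i j; rewrite !mxE; congr (_ * _).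
  by have [->|_] := eqVneq i j; last rewrite orbC.
(* Symmetry of M makes the Gram matrix G of the eigenvectors commute with Lambda; hence (lambda_l -
   lambda_k) G_kl = 0, and distinct eigenvalues kill the off-diagonal entries. *)
have : (Vmx om)^T *m Vmx om *m Lambdamx om = Lambdamx om *m ((Vmx om)^T *m Vmx om).
  rewrite -mulmxA -MV !mulmxA; congr (_ *m _).
  by rewrite -[LHS]trmxK trmx_mul trmxK MT MV trmx_mul tr_diag_mx.
set G := _^T *m _ => GL; apply/matrixP => k l; rewrite [in RHS]mxE.
have [<-|kl] := eqVneq k l.
  rewrite mxE -[RHS](vcomp_norm (om_itv k)); apply: eq_bigr => j _.
  by rewrite !mxE expr2.
have /matrixP/(_ k l) := GL; rewrite mul_mx_diag mul_diag_mx !mxE => /eqP.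
rewrite mulrC -subr_eq0 -mulrBl mulf_eq0 subr_eq0 => /orP[/eqP lkl|/eqP //].
by have /eqP := lambda_inj om_itv om_inj lkl; rewrite eq_sym (negbTE kl).
Qed.

End Eigenvectors.

(** * The boundary value problem *)

Section DiagonalBVP.
Context {R : realType} {m : nat}.
Implicit Types (T c : R) (d : 'rV[R]_m) (w : 'cV[R]_m) (f eta pr : R -> 'cV[R]_m).

Lemma has_deriv_onP T f f' : has_deriv_on T f f' <->
  forall i t, t \in `[0, T] ->
    deriv_within [set` `[0, T]] (fun s => f s i 0) t (f' t i 0).
Proof.
split=> [fP i t tT | fP t tT].
  have /cvg_mxP/(_ i 0) := fP t tT.
  by rewrite /deriv_within; under eq_fun do rewrite !mxE.
apply/cvg_mxP => i j; rewrite ord1; have := fP i t tT.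
by rewrite /deriv_within; under [X in _ -> X @ _ --> _]eq_fun do rewrite !mxE.
Qed.

Lemma has_deriv_on_mulmx n T (A : 'M[R]_(n, m)) f f' : has_deriv_on T f f' ->
  has_deriv_on T (fun t => A *m f t) (fun t => A *m f' t).
Proof.
move=> /has_deriv_onP fP t tT; apply/cvg_mxP => i j; rewrite ord1 mxE.
have := deriv_within_sum (r := index_enum 'I_m) (c := A i) (fun k => fP k t tT).
rewrite /deriv_within; apply: cvg_trans; apply: near_eq_cvg; apply: nearW => s.
by rewrite !mxE.
Qed.

(** This is [c] times the finite-horizon controllability Gramian of the pair ([diag_mx d], [w]): the
    integral over [0, T] of e^(sD) w w^T e^(sD), D = [diag_mx d]. *)
Definition gramian T c d w : 'M[R]_m :=
  \matrix_(k, l) (c * w k 0 * primexp (d 0 k + d 0 l) T * w l 0).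

(** The quadratic form at [x] is [c] times the Gram sum of [primexp_gram_ge0] with coefficients x_k
    w_k. *)
Lemma gramian_psd T c d w : 0 <= T -> 0 <= c -> psdmx (gramian T c d w).
Proof.
move=> T0 c0; split.
  by apply/matrixP => k l; rewrite !mxE [d 0 l + _]addrC; ring.
move=> x; have := primexp_gram_ge0 (d 0) (fun k => x k 0 * w k 0) T0.
move=> /(mulr_ge0 c0); rewrite -mulmxA mxE mulr_sumr; congr (_ <= _).
apply: eq_bigr => k _; rewrite !mxE !mulr_sumr; apply: eq_bigr => l _.
by rewrite !mxE; ring.
Qed.

Lemma diag_bvp_entry c d w (x y : 'cV[R]_m) k :
  (diag_mx d *m x - c *: (w *m w^T *m y)) k 0 =
  d 0 k * x k 0 - c * w k 0 * \sum_l w l 0 * y l 0.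
Proof.
rewrite mul_diag_mx -mulmxA !mxE big_ord1 !mxE; congr (_ - _).
by rewrite mulrA; congr (_ * _); apply: eq_bigr => l _; rewrite mxE.
Qed.

Lemma diag_bvp_terminal T c d w eta pr : 0 <= T ->
  has_deriv_on T eta (fun t => diag_mx d *m eta t - c *: (w *m w^T *m pr t)) ->
  has_deriv_on T pr (fun t => - (diag_mx d *m pr t)) ->
  eta T = diag_mx (map_mx expR (T *: d)) *m eta 0 - gramian T c d w *m pr T.
Proof.
move=> T0 /has_deriv_onP etaP /has_deriv_onP prP.
have TT : T \in `[0, T] by rewrite in_itv /= T0 lexx.
(* The adjoint equation is integrated backwards from T: multiplying by e^(d_l s) makes each
   component constant. *)
have prE l t : t \in `[0, T] -> pr t l 0 = expR (d 0 l * T) * expR (- d 0 l * t) * pr T l 0.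
  move=> tT; pose g s := pr s l 0 * expR (d 0 l * s).
  have g0 s : s \in `[0, T] -> deriv_within [set` `[0, T]] g s 0.
    move=> sT; have := deriv_withinM (prP l s sT) (is_derive_expRM (d 0 l) s).
    by rewrite mul_diag_mx !mxE (_ : _ + _ = 0) //; ring.
  have : g t = g T by rewrite !(deriv_within_0_cst g0).
  rewrite /g => gE; rewrite mulrAC [_ * pr T l 0]mulrC -gE -mulrA -expRD.
  by rewrite mulNr subrr expR0 mulr1.
apply/colP => k.
(* After inserting the explicit adjoint, [b l] collects the time-independent part of the l-th
   forcing term; what remains, including the integrating factor, is e^(-(d_k + d_l) s). *)
pose b l := c * w k 0 * (w l 0 * (expR (d 0 l * T) * pr T l 0)).
(* Variation of constants: [g] has derivative 0. *)
pose g s := eta s k 0 * expR (- d 0 k * s)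
  + \sum_l b l * primexp (- (d 0 k + d 0 l)) s.
have g0 s : s \in `[0, T] -> deriv_within [set` `[0, T]] g s 0.
  move=> sT; have := deriv_withinD
    (deriv_withinM (etaP k s sT) (is_derive_expRM (- d 0 k) s))
    (deriv_within_sum (r := index_enum 'I_m) (c := b) (fun l =>
      is_derive_deriv_within (is_derive_primexp (- (d 0 k + d 0 l)) s))).
  rewrite diag_bvp_entry (_ : _ + _ = 0) //.
  have -> : \sum_l b l * expR (- (d 0 k + d 0 l) * s) =
      expR (- d 0 k * s) * (c * w k 0 * \sum_l w l 0 * pr s l 0).
    rewrite !mulr_sumr; apply: eq_bigr => l _.
    by rewrite (prE l s sT) /b [- (d 0 k + _)]opprD mulrDl expRD; ring.
  by ring.
have := deriv_within_0_cst g0 TT; rewrite /g mulr0 expR0 mulr1.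
rewrite [X in _ = _ + X]big1 => [|l _]; last by rewrite primexp0 mulr0.
rewrite addr0 mul_diag_mx !mxE => <-.
have eN : expR (T * d 0 k) * expR (- d 0 k * T) = 1.
  by rewrite -expRD mulrC mulNr subrr expR0.
rewrite mulrDr mulrCA eN mulr1 -addrA -[LHS]addr0; congr (_ + _).
apply/esym/eqP; rewrite subr_eq0; apply/eqP.
rewrite mulr_sumr; apply: eq_bigr => l _; rewrite mxE /b.
(* The factors e^(d_k T) and e^(d_l T) combine into the exponential that [primexpN] absorbs, leaving
   the entry of the Gramian. *)
rewrite -(primexpN (d 0 k + d 0 l)) mulrDl expRD [T * _]mulrC; ring.
Qed.

(** The adjoint does not involve [eta], so its terminal value can be prescribed freely; the coupling
    p(T) = y(T) - yhat is imposed later by choosing [prT]. *)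
Lemma diag_bvp_exists T c d w (eta0 prT : 'cV[R]_m) :
  exists eta pr, [/\
    has_deriv_on T eta (fun t => diag_mx d *m eta t - c *: (w *m w^T *m pr t)),
    has_deriv_on T pr (fun t => - (diag_mx d *m pr t)),
    eta 0 = eta0 & pr T = prT].
Proof.
pose q l := expR (d 0 l * T) * prT l 0.
pose pr t : 'cV[R]_m := \col_l (q l * expR (- d 0 l * t)).
pose b k l := c * w k 0 * (w l 0 * q l).
pose eta t : 'cV[R]_m := \col_k
  ((eta0 k 0 - \sum_l b k l * primexp (- (d 0 k + d 0 l)) t) * expR (d 0 k * t)).
exists eta, pr; split.
- apply/has_deriv_onP => k t tT; rewrite diag_bvp_entry.
  have etaE s : eta s k 0 = (eta0 k 0
      + \sum_l - b k l * primexp (- (d 0 k + d 0 l)) s) * expR (d 0 k * s).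
    by rewrite mxE -sumrN; under [in LHS]eq_bigr do rewrite -mulNr.
  rewrite etaE (eq_fun etaE).
  have := deriv_withinM (deriv_withinD
      (is_derive_deriv_within (S := [set` `[0, T]]) (is_derive_cst (eta0 k 0) t 1))
      (deriv_within_sum (r := index_enum 'I_m) (c := fun l => - b k l) (fun l =>
      is_derive_deriv_within (S := [set` `[0, T]])
        (is_derive_primexp (- (d 0 k + d 0 l)) t))))
    (is_derive_expRM (d 0 k) t).
  congr (deriv_within _ _ _ _); rewrite add0r addrC mulrCA; congr (_ + _).
  rewrite mulr_suml mulr_sumr -sumrN; apply: eq_bigr => l _.
  rewrite mxE /b opprD mulrDl expRD [- d 0 k * t]mulNr expRN.
  by field; rewrite expR_eq0.
- apply/has_deriv_onP => l t tT; rewrite mul_diag_mx !mxE.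
  rewrite (_ : (fun s => pr s l 0) = fun s => expR (- d 0 l * s) * q l); last first.
    by apply/funext => s; rewrite mxE mulrC.
  have := deriv_withinM
    (is_derive_deriv_within (S := [set` `[0, T]]) (is_derive_expRM (- d 0 l) t))
    (is_derive_cst (q l) t 1).
  by congr (deriv_within _ _ _ _); rewrite /cst; ring.
- apply/colP => k; rewrite mxE mulr0 expR0 mulr1 big1 ?subr0 // => l _.
  by rewrite primexp0 mulr0.
- apply/colP => l; rewrite mxE /q mulrAC -expRD mulNr subrr expR0 mul1r //.
Qed.

(** A row [u] of the left kernel satisfies 0 = u (I + A) u^T >= u u^T, hence vanishes. *)
Lemma add1_psd_unit (A : 'M[R]_m) : psdmx A -> 1%:M + A \in unitmx.
Proof.
move=> [AT A0]; rewrite -row_free_unit -kermx_eq0; apply/eqP/row_matrixP => i.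
rewrite row0; set u := row i _.
have u0 : u *m (1%:M + A) = 0 by rewrite -row_mul mulmx_ker row0.
have uu : (u *m u^T) 0 0 <= 0.
  have := A0 u^T; rewrite trmxK => uA0.
  have : (u *m (1%:M + A) *m u^T) 0 0 = 0 by rewrite u0 mul0mx mxE.
  by rewrite mulmxDr mulmx1 mulmxDl mxE; lra.
have sq_ge0 j : 0 <= u 0 j ^+ 2 by exact: sqr_ge0.
have /eqP : \sum_j u 0 j ^+ 2 = 0.
  apply/eqP; rewrite eq_le sumr_ge0 // andbT; apply: le_trans uu.
  by rewrite [leRHS]mxE; apply: ler_sum => j _; rewrite [u^T _ _]mxE expr2.
rewrite psumr_eq0 // => /allP u2; apply/rowP => j; rewrite [RHS]mxE.
by move: (u2 j (mem_index_enum j)); rewrite /= sqrf_eq0 => /eqP.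
Qed.

End DiagonalBVP.

(** * Transfer between the original and the diagonal boundary value problem *)

Theorem lemma2p3 (R : realType) (m : nat) (xi T alpha beta0 beta1 : R)
    (om : 'I_m -> R) (psi yhat : 'cV[R]_m)
    (hm : (2 <= m)%N) (hxi : xi = 1 / m%:R) (hT : 0 < T) (halpha : 0 < alpha)
    (hbeta0 : 0 <= beta0) (hbeta1 : 0 <= beta1)
    (hbeta : (beta0, beta1) <> (0, 0))
    (hom : is_freqs beta0 beta1 om) :
  let V := Vmx om in
  let Q := Qmx beta0 beta1 xi alpha T om in
  let represents (y eta : R -> 'cV[R]_m) :=
    forall t : R, t \in `[0, T] -> y t = V *m eta t in
  [/\ exists y p eta : R -> 'cV[R]_m,
        bvp_solution beta0 beta1 xi alpha T psi yhat y p /\ represents y eta,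
      forall y p eta : R -> 'cV[R]_m,
        bvp_solution beta0 beta1 xi alpha T psi yhat y p ->
        represents y eta ->
        eta 0 = V^T *m psi /\
        unique (fun x : 'cV[R]_m =>
                  (1%:M + Q) *m x
                  = expmx (T *: Lambdamx om) *m eta 0 + Q *m (V^T *m yhat))
               (eta T)
    & psdmx Q].
Proof.
move=> V Q represents.
have T0 := ltW hT.
have T0T : 0 \in `[0, T] /\ T \in `[0, T] by rewrite !in_itv /= !lexx T0.
have m0 : 0 < m%:R :> R by rewrite ltr0n (leq_trans _ hm).
have D0 : 2 * m%:R * beta1 + beta0 != 0.
  rewrite paddr_eq0 ?mulr_ge0 ?ler0n // !mulf_eq0 pnatr_eq0 /= (gt_eqF m0) /=.
  by apply/negP => /andP[/eqP b1 /eqP b0]; apply: hbeta; rewrite b0 b1.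
have [om_inj om_itv bc] := freqs_spec hom hbeta0 hbeta1.
have VV : V^T *m V = 1%:M := Vmx_orthogonal hm D0 om_inj om_itv bc.
have VV' : V *m V^T = 1%:M := mulmx1C VV.
pose M := Mmx m beta0 beta1 xi.
pose d : 'rV[R]_m := \row_k lambda om k.
have MV : M *m V = V *m diag_mx d by rewrite /M hxi; exact: Mmx_eigen.
have VM : V^T *m M = diag_mx d *m V^T.
  by rewrite -[LHS]mulmx1 -VV' mulmxA -(mulmxA V^T) MV mulmxA VV mul1mx.
pose c := gamma beta0 beta1 xi ^+ 2 / alpha.
have c0 : 0 <= c by rewrite divr_ge0 ?sqr_ge0 // ltW.
pose w := V^T *m e_last R m.
have QE : Q = gramian T c d w.
  have wE k : w k 0 = vcomp om k m.
    (* The zero-based index [m.-1] is the last one, so [w] is the last row of V, transposed. *)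
    have ml : (m.-1 < m)%N by rewrite prednK // (leq_trans _ hm).
    rewrite mxE (bigD1 (Ordinal ml)) //= !mxE /= prednK ?(leq_trans _ hm) //.
    rewrite eqxx mulr1 big1 ?addr0 // => j jm; rewrite !mxE.
    rewrite (_ : _ == m = false) ?mulr0 //; apply/negbTE.
    apply: contra jm => /eqP jm; apply/eqP/val_inj.
    exact: (congr1 predn jm).
  apply/matrixP => k l; rewrite [LHS]mxE [RHS]mxE !wE ![d _ _]mxE -phi1_scale /c.
  by rewrite -(mulrA (_ * T)); ring.
have Q_psd : psdmx Q by rewrite QE; exact: gramian_psd.
have Q_unit := add1_psd_unit Q_psd.
have expE : expmx (T *: Lambdamx om) = diag_mx (map_mx expR (T *: d)).
  by rewrite -expmx_diag linearZ.
split=> //.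
(* The future eta(T) is found first; it dictates the terminal adjoint x - V^T yhat, and the linear
   system then guarantees that the resulting [eta] indeed ends at [x]. *)
- pose x := invmx (1%:M + Q) *m
    (expmx (T *: Lambdamx om) *m (V^T *m psi) + Q *m (V^T *m yhat)).
  have [eta [pr [etaP prP eta0 prT]]] :=
    diag_bvp_exists T c d w (V^T *m psi) (x - V^T *m yhat).
  have etaT : eta T = x.
    rewrite (diag_bvp_terminal T0 etaP prP) eta0 prT -QE -expE mulmxBr.
    have : (1%:M + Q) *m x
        = expmx (T *: Lambdamx om) *m (V^T *m psi) + Q *m (V^T *m yhat).
      exact: mulKVmx.
    rewrite mulmxDl mul1mx => xE; apply: (addIr (Q *m x)).
    by rewrite xE opprB -addrA subrK.
  exists (fun t => V *m eta t), (fun t => V *m pr t), eta; split=> //; split.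
  + have := has_deriv_on_mulmx (A := V) etaP.
    congr (has_deriv_on _ _ _); apply/funext => t.
    by rewrite mulmxBr -scalemxAr /w trmx_mul trmxK !mulmxA -MV VV' mul1mx.
  + by rewrite eta0 mulmxA VV' mul1mx.
  + have := has_deriv_on_mulmx (A := V) prP.
    congr (has_deriv_on _ _ _); apply/funext => t.
    by rewrite mulmxN !mulmxA -MV.
  + by rewrite prT etaT mulmxBr !mulmxA VV' mul1mx.
- move=> y p eta [yP y0 pP pT] rep.
  have etaE t : t \in `[0, T] -> eta t = V^T *m y t.
    by move=> /rep ->; rewrite mulmxA VV mul1mx.
  have eta0 : eta 0 = V^T *m psi by rewrite etaE ?y0; case: T0T.
  (* [eta] is determined only on [0, T], so the diagonal system is stated for V^T y, which agrees
     with it there. *)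
  have etaP : has_deriv_on T (fun t => V^T *m y t)
      (fun t => diag_mx d *m (V^T *m y t) - c *: (w *m w^T *m (V^T *m p t))).
    have := has_deriv_on_mulmx (A := V^T) yP.
    congr (has_deriv_on _ _ _); apply/funext => t.
    rewrite mulmxBr -scalemxAr /w trmx_mul trmxK !mulmxA -VM.
    by rewrite -[in RHS](mulmxA _ V) VV' mulmx1.
  have prP : has_deriv_on T (fun t => V^T *m p t)
      (fun t => - (diag_mx d *m (V^T *m p t))).
    have := has_deriv_on_mulmx (A := V^T) pP.
    congr (has_deriv_on _ _ _); apply/funext => t.
    by rewrite mulmxN !mulmxA -VM.
  have etaT : eta T =
      expmx (T *: Lambdamx om) *m eta 0 - Q *m (eta T - V^T *m yhat).
    rewrite {1}etaE ?(diag_bvp_terminal T0 etaP prP); last by case: T0T.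
    by rewrite -QE -expE y0 -eta0 pT mulmxBr -etaE //; case: T0T.
  have sol : (1%:M + Q) *m eta T =
      expmx (T *: Lambdamx om) *m eta 0 + Q *m (V^T *m yhat).
    by rewrite mulmxDl mul1mx {1}etaT mulmxBr opprB -addrA subrK.
  (* Any other solution has the same image under the invertible matrix I + Q. *)
  split=> //; split=> // x xE; apply: (can_inj (mulKmx Q_unit)).
  by rewrite xE -sol.
Qed.
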